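(* Let $q=p^e$ be an odd prime power with $q\equiv 2\pmod 3$, and let $4\le k\le q+1$. Let $g_i(X)=X^3$ and $f_i(X)=X^{i-1}$ for each $3\le i\le k$. Then $S(k,q)=S(k,q;f_3,g_3,\ldots,f_k,g_k)$ is connected and $$\lambda_2(S(k,q))=\max\{q(k-3),\,(q-1)M_q\},$$ where $M_q=\max_{a,b\in\mathbb{F}_q^*}\varepsilon_{ax^3+bx}$, and moreover $M_q\le 2\sqrt q$.
   Context: For a prime power $q$, integer $k\ge3$, and polynomials $f_i,g_i\in\mathbb{F}_q[X]$ ($3\le i\le k$) of degree at most $q-1$ with $g_i(-X)=-g_i(X)$, the graph $S(k,q;f_3,g_3,\ldots,f_k,g_k)$ is the simple graph with vertex set $\mathbb{F}_q^k$ in which $a=(a_1,\ldots,a_k)$ and $b=(b_1,\ldots,b_k)$ are adjacent iff $a_1\ne b_1$ and $b_i-a_i=g_i(b_1-a_1)\,f_i\!\left(\frac{b_2-a_2}{b_1-a_1}\right)$ for all $3\le i\le k$. $\lambda_2$ is the second largest adjacency eigenvalue. With $q=p^e$, $Tr(\alpha)=\alpha+\alpha^p+\cdots+\alpha^{p^{e-1}}\in\mathbb{F}_p$, $\zeta_p=\exp(2\pi i/p)$, and $\zeta_p^\beta$ for $\beta\in\mathbb{F}_p$ means $\zeta_p^{\beta^*}$ with $\beta^*\in\{0,\ldots,p-1\}$ the representative of $\beta$. For $f\in\mathbb{F}_q[X]$, the exponential sum is $\varepsilon_f=\sum_{x\in\mathbb{F}_q}\zeta_p^{Tr(f(x))}$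 (a real number when $f$ is odd). *)

(* Defs.v *)
From HB Require Import structures.
From mathcomp Require Import all_boot all_order all_algebra all_field.
Set Implicit Arguments. Unset Strict Implicit. Unset Printing Implicit Defensive.
Import Order.TTheory GRing.Theory Num.Theory.
Local Open Scope ring_scope.

Section Defs.
Variable F : finFieldType.

(* coordinate n (0-based) of a vertex of F^k; coordinate n corresponds to
   the paper's a_{n+1} *)
Definition coord (k : nat) (a : {ffun 'I_k -> F}) (n : nat) : F :=
  if insub n is Some i then a i else 0.

(* Adjacency of S(k,q; f_3,g_3,...,f_k,g_k); f g indexed by the paper's index i *)
Definition S_adj (k : nat) (f g : nat -> {poly F}) : rel {ffun 'I_k -> F} :=
  fun a b =>
    (coord a 0 != coord b 0) &&
    [forall i : 'I_k, (2 <= i)%N ==>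
       (b i - a i ==
        (g i.+1).[coord b 0 - coord a 0] *
        (f i.+1).[(coord b 1 - coord a 1) / (coord b 0 - coord a 0)])].

Definition Tr (p e : nat) (x : F) : F := \sum_(j < e) x ^+ (p ^ j).

Definition prime_rep (p : nat) (y : F) : nat :=
  index y [seq (i%:R : F) | i <- iota 0 p].

Definition zeta_p (p : nat) : algC := (p.-root (-1)) ^+ 2.

Definition psi (p e : nat) (x : F) : algC := (zeta_p p) ^+ prime_rep p (Tr p e x).

Definition eps (p e : nat) (f : {poly F}) : algC := \sum_(x : F) psi p e f.[x].

(* M_q = max_{a,b in F^*} eps_{a x^3 + b x}; the fold starts at the member
   (a,b) = (1,1) of the family, so it is exactly the maximum *)
Definition Mq (p e : nat) : algC :=
  \big[Num.max/eps p e ('X^3 + 'X)]_(a : F | a != 0)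
    \big[Num.max/eps p e ('X^3 + 'X)]_(b : F | b != 0)
       eps p e (a *: 'X^3 + b *: 'X).
End Defs.

Definition adj_mx (T : finType) (e : rel T) : 'M[algC]_#|T| :=
  \matrix_(i, j) (e (enum_val i) (enum_val j))%:R.

Definition is_lambda2 (n : nat) (A : 'M[algC]_n) (x : algC) : Prop :=
  exists rs : seq algC,
    [/\ char_poly A = \prod_(r <- rs) ('X - r%:P),
        sorted (fun u v => v <= u) rs & rs`_1 = x].

Definition connected_graph (T : finType) (e : rel T) : Prop :=
  forall a b : T, connect e a b.

(* Main.v *)
Require Import Defs.
From HB Require Import structures.
From mathcomp Require Import all_boot all_order all_algebra all_field.
From mathcomp Require Import ring zify.
Import Order.TTheory GRing.Theory Num.Theory.
Local Open Scope ring_scope.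
Set Implicit Arguments.
Unset Strict Implicit.
Unset Printing Implicit Defensive.

(** The graph is a Cayley graph of F^k, so its eigenvalues are
      lambda_w = sum_y eps(h_w(y) x^3 + (w_1 + w_2 y) x) - q,
      h_w(y) = sum_(i >= 3) w_i y^(i-1),
    one for each w in F^k.  Cubing permutes F, so a summand vanishes as soon as
    exactly one of the two coefficients is zero.  If w_1 = w_2 = 0 this leaves
    q (N - 1) with N <= k - 2 the number of zeros of h_w; otherwise the linear
    coefficient vanishes at most once and lambda_w <= (q - 1) M_q.  Equality in
    the second case comes from h_w(y) = a y^3 and linear coefficient b y, since
    eps(a y^3 x^3 + b y x) does not depend on y <> 0.

    For the Weil bound eps <= 2 sqrt q:  over the quadratic
    extension the cubic sum becomes 2q - eps^2, so
    if eps^2 > 4q then eps^2/q - 4 grows at least fourfold each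
    time the degree doubles.  This contradicts the bound |eps| <= 7 p sqrt q over
    fields of square order, which follows from a Stepanov auxiliary polynomial. *)

(** * Additive characters of a finite field *)

Lemma exprDn_pchar_pow (R : comNzRingType) p n (x y : R) :
  p \in [pchar R] -> (x + y) ^+ (p ^ n) = x ^+ (p ^ n) + y ^+ (p ^ n).
Proof.
move=> pR; apply: exprDn_pchar; rewrite pnatX; apply/orP; left.
by rewrite (eq_pnat _ (pcharf_eq pR)) pnat_id ?(pcharf_prime pR).
Qed.

Lemma expr_sum_pchar (R : comNzRingType) p n (I : Type) (s : seq I) (P : pred I)
  (G : I -> R) : p \in [pchar R] ->
  (\sum_(i <- s | P i) G i) ^+ (p ^ n) = \sum_(i <- s | P i) G i ^+ (p ^ n).
Proof.
move=> pR; apply: (big_morph (fun x => x ^+ (p ^ n))) => [x y|].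
  exact: exprDn_pchar_pow.
by rewrite expr0n expn_eq0 eqn0Ngt prime_gt0 ?(pcharf_prime pR).
Qed.

(** The order divides the prime [p], so it is enough to exclude order 1, that is [z = 1] or
    [z = -1]. The first contradicts [z ^+ p = -1], the second the choice of the principal root. *)
Lemma zeta_p_prim p : prime p -> odd p -> p.-primitive_root (zeta_p p).
Proof.
move=> pp op; have p_gt0 := prime_gt0 pp; have p_gt1 := prime_gt1 pp.
pose z : algC := p.-root (-1).
have zp : z ^+ p = -1 by rewrite rootCK.
have zetap : zeta_p p ^+ p = 1 by rewrite /zeta_p exprAC -/z zp sqrrN expr1n.
have [m] := prim_order_exists p_gt0 zetap.
move=> prim_m m_dv_p.
move: pp => /primeP[_ /(_ m m_dv_p)/orP[]/eqP em]; last by rewrite em in prim_m.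
move: prim_m; rewrite em => /prim_expr_order; rewrite expr1 /zeta_p -/z => /eqP.
rewrite sqrf_eq1 => /orP[]/eqP z1.
  move: zp; rewrite z1 expr1n => /eqP.
  by rewrite -subr_eq0 opprK -(natrD _ 1 1) pnatr_eq0.
have [w wprim] := C_prim_root_exists p_gt0.
(* [p.-root] has maximal real part among the roots in the upper half plane;
   were it -1, every p-th root of -1 would be -1. *)
have key (y : algC) : y ^+ p = -1 -> 0 <= 'Im y -> y = -1.
  move=> yp yIm; have := rootC_Re_max p_gt0 yp yIm.
  rewrite -/z z1 raddfN /= (Creal_ReP 1 _) ?rpred1 // => Rey.
  have ny : `|y| = 1.
    apply/eqP; rewrite -(@pexpr_eq1 _ _ p) // -normrX yp normrN normr1 //.
  have Ry2 : 'Re y ^+ 2 + 'Im y ^+ 2 = 1 by rewrite -normC2_Re_Im ny expr1n.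
  have Re2 : 1 <= 'Re y ^+ 2.
    rewrite -sqrrN -[X in X <= _](expr1n _ 2) ler_pXn2r //.
    - by rewrite lerNr.
    - by rewrite nnegrE ler01.
    by rewrite nnegrE (le_trans ler01) // lerNr.
  have Im0 : 'Im y = 0.
    apply/eqP; rewrite -sqrf_eq0 eq_le; apply/andP; split; last first.
      by rewrite exprn_ge0.
    by rewrite -Ry2 gerDl in Re2.
  have : 'Re y ^+ 2 = 1 by rewrite -[RHS]Ry2 Im0 expr0n addr0.
  move/eqP; rewrite sqrf_eq1 => /orP[]/eqP Ry.
    by move: Rey; rewrite Ry -subr_ge0 -opprD oppr_ge0 -(natrD _ 1 1) lern0.
  by rewrite [y]Crect Ry Im0 mulr0 addr0.
have key2 (y : algC) : y ^+ p = -1 -> y = -1.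
  move=> yp; have [?|/ltW Iy] := real_leP (rpred0 _) (Creal_Im y); first exact: key.
  rewrite -[y]conjCK (key y^*) ?rmorphN ?rmorph1 -?rmorphXn ?yp ?rmorphN ?rmorph1 //.
  by rewrite Im_conj oppr_ge0.
(* As [p] is odd, the negative of a primitive [p]-th root of unity [w] is a [p]-th root of -1; hence
   [w = 1] and [p = 1]. *)
have : - w = -1 by apply: key2; rewrite exprNn (prim_expr_order wprim) mulr1 -signr_odd op.
move/oppr_inj => w1; have := prim_order_dvd wprim 1.
by rewrite expr1 w1 eqxx dvdn1 => /eqP p1; rewrite p1 in p_gt1.
Qed.

Lemma zeta_p_norm p : prime p -> odd p -> `|zeta_p p| = 1.
Proof.
move=> hp hodd; apply/eqP; rewrite -(@pexpr_eq1 _ _ p) ?prime_gt0 // -normrX.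
by rewrite (prim_expr_order (zeta_p_prim hp hodd)) normr1.
Qed.

Section AdditiveCharacter.
Variables (F : finFieldType) (p e : nat).
Hypotheses (hp : prime p) (hF : #|F| = (p ^ e)%N).
Local Notation psi := (@psi F p e).
Local Notation Tr := (@Tr F p e).

Let pF : p \in [pchar F] := card_finPcharP hF hp.

Lemma TrD x y : Tr (x + y) = Tr x + Tr y.
Proof.
by rewrite -big_split; apply: eq_bigr => j _; rewrite exprDn_pchar_pow.
Qed.

(** Frobenius shifts the summands cyclically, because [x ^+ (p ^ e) = x]. *)
Lemma Tr_frob x : Tr x ^+ p = Tr x.
Proof.
have -> : Tr x ^+ p = \sum_(j < e) (x ^+ (p ^ j)) ^+ (p ^ 1).
  by rewrite -expr_sum_pchar // expn1.
under eq_bigr do rewrite expn1 -exprM -expnSr.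
rewrite /Defs.Tr.
case: e hF => [|m] hm; first by rewrite !big_ord0.
rewrite big_ord_recr /= -hm expf_card [in RHS]big_ord_recl expn0 expr1 addrC.
by congr (_ + _); apply: eq_bigr.
Qed.

Lemma natF_inj : {in [pred i | (i < p)%N] &, injective (fun i : nat => i%:R : F)}.
Proof.
move=> i j /=; rewrite !inE => ip jp /= eij.
wlog lij : i j ip jp eij / (i <= j)%N.
  by move=> H; case: (leqP i j) => [|/ltnW] /H; [apply|move=> ->].
have : (p %| j - i)%N by rewrite (dvdn_pcharf pF) natrB // eij subrr.
by move=> d; apply/eqP; rewrite eqn_leq lij /= -subn_eq0;
  move: d; apply: contraLR; rewrite -lt0n => h; rewrite gtnNdvd //; lia.
Qed.

(** [index] returns the length [p] for an absent element. If [y] were absent, [X^p - X] would have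
    [p + 1] roots: [y] and the [p] elements of the prime field. *)
Lemma prime_rep_lt (y : F) : y ^+ p = y -> (prime_rep p y < p)%N.
Proof.
move=> yp; rewrite -[X in (_ < X)%N](size_iota 0) -(size_map (fun i => i%:R : F)) index_mem.
set s := map _ _.
have us : uniq s.
  rewrite map_inj_in_uniq ?iota_uniq // => i j.
  by rewrite !mem_iota /= => *; apply: natF_inj.
apply: contraT => yns.
have szP : size ('X^p - 'X : {poly F}) = p.+1.
  by rewrite size_polyDl size_polyXn // size_polyN size_polyX ltnS prime_gt1.
have := @max_poly_roots F ('X^p - 'X) (y :: s).
rewrite -size_poly_eq0 szP /= yns us size_map size_iota ltnn.
rewrite /root !hornerE yp subrr eqxx /= => H; apply: H => //.
apply/allP=> _ /mapP[i _ ->]; rewrite /root !hornerE.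
by rewrite -[_ ^+ p](pFrobenius_autE pF) pFrobenius_aut_nat subrr.
Qed.

Lemma prime_rep_natK (y : F) : y ^+ p = y -> (prime_rep p y)%:R = y.
Proof.
move=> yp; have ilt := prime_rep_lt yp; pose s := [seq (i%:R : F) | i <- iota 0 p].
have ys : y \in s by rewrite -index_mem size_map size_iota.
have := nth_index 0 ys; rewrite /prime_rep -/s => {2}<-.
by rewrite (nth_map 0%N) ?size_iota // nth_iota.
Qed.

Hypothesis hodd : odd p.

Lemma zeta_nat_eq m n : m%:R = n%:R :> F -> zeta_p p ^+ m = zeta_p p ^+ n.
Proof.
move=> emn; apply/eqP; rewrite (eq_prim_root_expr (zeta_p_prim hp hodd)).
wlog lmn : m n emn / (m <= n)%N.
  by move=> H; case: (leqP m n) => [|/ltnW] /H; [apply|rewrite eq_sym; apply].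
by rewrite eq_sym eqn_mod_dvd // (dvdn_pcharf pF) natrB // emn subrr.
Qed.

(** Any natural number representing the trace may serve as exponent, so additivity of [psi] reduces
    to addition of exponents. *)
Lemma psi_nat x n : Tr x = n%:R -> psi x = zeta_p p ^+ n.
Proof. by move=> h; apply: zeta_nat_eq; rewrite prime_rep_natK // Tr_frob. Qed.

Lemma psiD x y : psi (x + y) = psi x * psi y.
Proof.
rewrite -exprD; apply: psi_nat.
by rewrite TrD natrD !prime_rep_natK ?Tr_frob.
Qed.

Lemma psi0 : psi 0 = 1.
Proof.
rewrite (@psi_nat 0 0) //.
by apply: big1 => j _; rewrite expr0n expn_eq0 eqn0Ngt prime_gt0.
Qed.

Lemma psi_norm x : `|psi x| = 1.
Proof.
by rewrite normrX zeta_p_norm // expr1n.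
Qed.

Lemma psi_conj x : (psi x)^* = psi (- x).
Proof.
apply: (mulfI (x := psi x)); first by rewrite -normr_eq0 psi_norm oner_neq0.
by rewrite -normCK psi_norm expr1n -psiD subrr psi0.
Qed.

Hypothesis he : (0 < e)%N.

(** The trace is a polynomial of degree [p ^ e.-1], less than the order of [F], so it cannot vanish
    on all of [F]. *)
Lemma Tr_neq0 : exists x, Tr x != 0.
Proof.
apply/existsP; apply: contraT; rewrite negb_exists => /forallP H.
pose P : {poly F} := \sum_(j < e) 'X^(p ^ j).
have sz : size P = (p ^ e.-1).+1.
  rewrite /P; case: e he => // m _; rewrite big_ord_recr /= addrC size_polyDl size_polyXn //.
  rewrite ltnS (leq_trans (size_sum _ _ _)) //; apply/bigmax_leqP => j _.
  by rewrite size_polyXn ltn_exp2l ?prime_gt1.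
have := @max_poly_roots F P (enum F).
rewrite -size_poly_eq0 sz enum_uniq -cardE hF ltnS leqNgt.
have -> : (p ^ e.-1 < p ^ e)%N by rewrite ltn_exp2l ?prime_gt1 ?prednK.
move=> K; suff: false by []; apply: K => //; apply/allP => x _.
have /negPn/eqP Tx := H x; rewrite /root /P horner_sum -[X in _ == X]Tx.
by apply/eqP; apply: eq_bigr => j _; rewrite hornerXn.
Qed.

(** Translating [x] by [t / c] multiplies the sum by [psi t], which differs from 1 when [Tr t] is
    nonzero. *)
Lemma sum_psi c : c != 0 -> \sum_x psi (c * x) = 0.
Proof.
move=> c0; have [t Tt] := Tr_neq0.
have pt : psi t != 1.
  rewrite /Defs.psi -(prim_order_dvd (zeta_p_prim hp hodd)) (dvdn_pcharf pF).
  by rewrite prime_rep_natK ?Tr_frob.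
have E : psi t * \sum_x psi (c * x) = \sum_x psi (c * x).
  rewrite mulr_sumr (reindex_inj (addrI (- (t / c)))) /=.
  apply: eq_bigr => x _; rewrite -psiD; congr psi.
  by rewrite mulrDr mulrN mulrCA divff // mulr1 addNKr.
apply/eqP; apply: contraNT pt => s0; apply/eqP.
by apply: (mulIf s0); rewrite E mul1r.
Qed.

End AdditiveCharacter.

(** * Stepanov bound over fields of square order *)

(** The degrees are distinct, so the leading term of the largest polynomial with nonzero coefficient
    cannot cancel. *)
Lemma lincomb_poly_neq0 (R : idomainType) (I : finType) (P : I -> {poly R})
    (c : I -> R) i0 :
  injective (fun i => size (P i)) -> (forall i, P i != 0) -> c i0 != 0 ->
  \sum_i c i *: P i != 0.
Proof.
move=> injP P0 ci0; case: (@arg_maxnP _ i0 (fun i => c i != 0) (fun i => size (P i)) ci0).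
move=> i ci imax; apply/eqP => /(congr1 (fun q : {poly R} => q`_(size (P i)).-1)).
rewrite coef0 coef_sum (bigD1 i) //= big1 => [|j ji].
  rewrite addr0 coefZ; apply/eqP; rewrite mulf_neq0 //.
  by rewrite -lead_coefE lead_coef_eq0.
rewrite coefZ; have [->|cj] := eqVneq (c j) 0; first by rewrite mul0r.
rewrite [X in _ * X]nth_default ?mulr0 //.
have /= := imax _ cj; have := size_poly_gt0 (P i); rewrite P0.
have /eqP : size (P j) <> size (P i) by move/injP => eji; rewrite eji eqxx in ji.
by move: (size (P i)) (size (P j)) => a b; lia.
Qed.

Lemma poly_lin_dep (F : fieldType) (I : finType) (N : nat) (P : I -> {poly F}) :
  (N < #|I|)%N -> (forall i, (size (P i) <= N)%N) ->
  exists2 c : I -> F, (exists i, c i != 0) & \sum_i c i *: P i = 0.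
Proof.
move=> NI szP.
pose M : 'M[F]_(#|I|, N) := \matrix_(i, j) (P (enum_val i))`_j.
have : kermx M != 0.
  rewrite -mxrank_eq0 mxrank_ker -lt0n subn_gt0 (leq_ltn_trans _ NI) //.
  exact: rank_leq_col.
case/rowV0Pn => v /sub_kermxP vM v0; exists (fun i => v 0 (enum_rank i)).
  have [j vj] : exists j, v 0 j != 0.
    apply/existsP; apply: contraNT v0; rewrite negb_exists => /forallP H.
    by apply/eqP/rowP => j; rewrite mxE; apply/eqP; rewrite -[_ == _]negbK.
  by exists (enum_val j); rewrite enum_valK.
apply/polyP => n; rewrite coef0 coef_sum.
case: (ltnP n N) => [nN|Nn]; last first.
  by apply: big1 => i _; rewrite coefZ [X in _ * X]nth_default ?mulr0 // (leq_trans (szP i)).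
have := congr1 (fun w : 'rV_N => w 0 (Ordinal nN)) vM; rewrite !mxE => vMn; rewrite -[RHS]vMn.
rewrite (reindex (@enum_rank I)); last first.
  by exists enum_val => x _; rewrite ?enum_rankK ?enum_valK.
by apply: eq_bigr => i _; rewrite coefZ mxE enum_rankK.
Qed.

Section Stepanov.
Variables (K : finFieldType) (p m : nat).
Hypotheses (hp : prime p) (hp5 : (5 <= p)%N) (hm : (0 < m)%N).
Hypothesis hK : #|K| = (p ^ (m + m))%N.
Local Notation r := (p ^ m)%N.
Local Notation A := (p ^ m.-1)%N.

Let pK : p \in [pchar K] := card_finPcharP hK hp.
Let rpA : r = (p * A)%N. Proof. by rewrite -expnS prednK. Qed.
Let A_gt0 : (0 < A)%N. Proof. by rewrite expn_gt0 prime_gt0. Qed.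

Lemma Tr_half (x : K) : Tr p (m + m) x = Tr p m x + Tr p m x ^+ r.
Proof.
rewrite {1}/Tr big_split_ord /=; congr (_ + _); rewrite expr_sum_pchar //.
by apply: eq_bigr => j _; rewrite -exprM -expnD addnC.
Qed.

Variable f : {poly K}.
Hypothesis szf : size f = 4%N.

(* [T.[x]] is the partial trace; a solution of Tr f(x) = t satisfies
   [T.[x] ^+ r = t - T.[x]], which lets r-th powers of [T] be reduced. *)
Let T : {poly K} := \sum_(j < m) f ^+ (p ^ j).

Let hornerT x : T.[x] = Tr p m f.[x].
Proof. by rewrite horner_sum; apply: eq_bigr => j _; rewrite horner_exp. Qed.

Let size_fX n : size (f ^+ n) = (3 * n).+1.
Proof.
have : size (f ^+ n) != 0%N by rewrite size_poly_eq0 expf_neq0 // -size_poly_eq0 szf.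
by have := size_exp f n; rewrite szf /=; case: (size _) => //= a ->.
Qed.

Let sizeT : size T = (3 * A).+1.
Proof.
rewrite /T; case: m hm => // n _; rewrite big_ord_recr /= addrC size_polyDl size_fX //.
rewrite ltnS (leq_trans (size_sum _ _ _)) //; apply/bigmax_leqP => j _.
by rewrite size_fX ltn_mul2l /= ltn_exp2l ?prime_gt1.
Qed.

Let size_TX n : size (T ^+ n) = (3 * A * n).+1.
Proof.
have : size (T ^+ n) != 0%N by rewrite size_poly_eq0 expf_neq0 // -size_poly_eq0 sizeT.
by have := size_exp T n; rewrite sizeT /=; case: (size _) => //= a ->.
Qed.

Let size_tTX (t : K) n : (size ((t%:P - T) ^+ n) <= (3 * A * n).+1)%N.
Proof.
have H : (size (t%:P - T)%R <= (3 * A).+1)%N.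
  by rewrite (leq_trans (size_polyD _ _)) // size_polyN sizeT geq_max leqnn andbT (leq_trans (size_polyC_leq1 _)).
have := size_exp (t%:P - T) n; case: (size _) => //= a ->.
by rewrite ltnS leq_mul2r; apply/orP; right; case: (size _) H.
Qed.

Lemma stepanov_count (t : K) :
  (#|[set x : K | Tr p (m + m) f.[x] == t]| <= r * (A + 7))%N.
Proof.
(* The triples number [r * A + 5 * r], while each [Q i] has size at most
   [r * A + 2 * r - 2 * A + 5], so the [Q i] are linearly dependent. The sizes of the [P i] stay
   below [r * (A + 7)] because [3 * A * (p - 1) < 3 * r]. *)
pose I := ('I_A * 'I_(A + 5) * 'I_p)%type.
pose P (i : I) : {poly K} := 'X^(i.1.1 + r * i.1.2) * T ^+ i.2.
pose Q (i : I) : {poly K} := 'X^(r * i.1.1 + i.1.2) * (t%:P - T) ^+ i.2.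
have szP i : size (P i) = (i.1.1 + r * i.1.2 + 3 * A * i.2).+1.
  rewrite /P mulrC size_mulXn -?size_poly_eq0 ?size_TX //; lia.
have szQ i : (size (Q i) <= (r * i.1.1 + i.1.2 + 3 * A * i.2).+1)%N.
  rewrite /Q; have [->|nz] := eqVneq ((t%:P - T) ^+ i.2) 0; first by rewrite mulr0 size_poly0.
  rewrite mulrC size_mulXn //; have := size_tTX t i.2; lia.
have bnd (a b c : nat) : (a < A -> b < A + 5 -> c < p ->
    [/\ r * a + b + 3 * A * c < r * (A - 1) + (A + 4) + 3 * A * (p - 1) + 1
      & a + r * b + 3 * A * c < r * (A + 7)])%N.
  move=> ha hb hc.
  have h1 : (r * a <= r * (A - 1))%N by rewrite leq_mul2l; lia.
  have h2 : (3 * A * c <= 3 * A * (p - 1))%N by rewrite leq_mul2l; lia.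
  have h3 : (r * b <= r * (A + 4))%N by rewrite leq_mul2l; lia.
  have h4 : (3 * A * (p - 1) + 3 * A = 3 * r)%N by rewrite rpA; nia.
  by split; first lia; rewrite mulnDr; rewrite mulnDr in h3; lia.
(* [G := \sum_i d i ^+ r *: P i] satisfies [G.[x] ^+ r = (\sum_i d i *: Q i).[x]]
   at every solution [x]; there are more coefficients than conditions for the
   right-hand side to vanish identically. *)
have [||d [i0 di0] dQ] := @poly_lin_dep K I (r * (A - 1) + (A + 4) + 3 * A * (p - 1) + 1) Q.
- rewrite !card_prod !card_ord.
  have h4 : (3 * A * (p - 1) + 3 * A = 3 * r)%N by rewrite rpA; nia.
  have h5 : (r * (A - 1) + r = r * A)%N by nia.
  have -> : (A * (A + 5) * p = r * A + 5 * r)%N by rewrite rpA; nia.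
  have : (A < r)%N by rewrite rpA; nia.
  lia.
- move=> [[a b] c]; apply: leq_trans (szQ _) _ => /=.
  by have [] := bnd _ _ _ (ltn_ord a) (ltn_ord b) (ltn_ord c); lia.
have dr i : (d i ^+ r) ^+ r = d i by rewrite -exprM -expnD -hK expf_card.
pose G := \sum_i d i ^+ r *: P i.
have G0 : G != 0.
  apply: (@lincomb_poly_neq0 _ _ P _ i0); last by rewrite expf_neq0.
    move=> [[a b] c] [[a' b'] c'] /=; rewrite !szP /= => -[] E.
    have [/= la la'] := (ltn_ord a, ltn_ord a').
    have [/= lc lc'] := (ltn_ord c, ltn_ord c').
    (* [3] is invertible mod [p], so the degree determines [a], [c], [b] in turn. *)
    have E1 : (a + A * (p * b + 3 * c) = a' + A * (p * b' + 3 * c'))%N.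
      by move: E; rewrite rpA; lia.
    have ea : a = a' :> nat.
      by have := congr1 (modn^~ A) E1; rewrite ![(_ + A * _)%N]addnC ![(A * _)%N]mulnC !modnMDl !modn_small.
    have E2 : (p * b + 3 * c = p * b' + 3 * c')%N.
      by move: E1; rewrite ea => /addnI/eqP; rewrite eqn_pmul2l // => /eqP.
    have ec : c = c' :> nat.
      have : (3 * c = 3 * c' %[mod p])%N.
        by have := congr1 (modn^~ p) E2; rewrite ![(p * _)%N]mulnC !modnMDl.
      have cop : coprime p 3 by rewrite prime_coprime // gtnNdvd //; lia.
      wlog: c c' lc lc' {E E1 E2} / (c <= c')%N.
        move=> H; case: (leqP c c') => h; first exact: H.
        by move=> e; apply/esym/H => //; apply: ltnW.
      move=> lcc /eqP; rewrite eq_sym eqn_mod_dvd ?leq_mul2l ?lcc ?orbT //.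
      rewrite -mulnBr Gauss_dvdr // => dv.
      have : (c' - c == 0)%N by apply: contraLR dv; rewrite -lt0n => h; rewrite gtnNdvd //; lia.
      by move=> /eqP; lia.
    have eb : b = b' :> nat.
      by move: E2; rewrite ec => /addIn/eqP; rewrite eqn_pmul2l ?prime_gt0 // => /eqP.
    by congr (_, _, _); apply: val_inj.
  by move=> i; rewrite -size_poly_eq0 szP.
have szG : (size G <= r * (A + 7))%N.
  apply: leq_trans (size_sum _ _ _) _; apply/bigmax_leqP => -[[a b] c] _.
  apply: leq_trans (size_scale_leq _ _) _; rewrite szP /=.
  by have [] := bnd _ _ _ (ltn_ord a) (ltn_ord b) (ltn_ord c).
apply: leq_trans szG; rewrite cardE ltnW // max_poly_roots ?enum_uniq //.
apply/allP => x; rewrite mem_enum inE Tr_half -hornerT => /eqP Tx.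
have Txr : T.[x] ^+ r = t - T.[x] by rewrite -Tx addrAC subrr add0r.
have xr : (x ^+ r) ^+ r = x by rewrite -exprM -expnD -hK expf_card.
suff : G.[x] ^+ r == 0 by rewrite expf_eq0 => /andP[].
have -> : 0 = (\sum_i d i *: Q i).[x] by rewrite dQ horner0.
apply/eqP; rewrite !horner_sum expr_sum_pchar //; apply: eq_bigr => i _.
rewrite !hornerZ exprMn dr /P /Q !hornerM !horner_exp !hornerX hornerD hornerN hornerC.
rewrite exprMn [(T.[x] ^+ _) ^+ _]exprAC Txr !exprD exprMn !exprM.
by rewrite [((x ^+ r) ^+ _) ^+ r]exprAC xr [(x ^+ i.1.1) ^+ r]exprAC.
Qed.

(** Upper bounds on the fibres of the trace suffice. The powers of [zeta_p p] sum to 0, so [eps] is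
    minus the sum weighted by the deficits [r * (A + 7) - N t]; these are nonnegative with total
    [p * r * (A + 7) - r * r = 7 * p * r]. *)
Lemma eps_stepanov_bound : `|eps p (m + m) f| <= (7 * p * r)%N%:R.
Proof.
have op : odd p by apply: contraLR hp5 => ev; case: (even_prime hp) => [->|] //; rewrite (negPf ev).
have z := zeta_p_prim hp op.
pose rep (x : K) := prime_rep p (Tr p (m + m) f.[x]).
have repK x : (rep x)%:R = Tr p (m + m) f.[x].
  by rewrite (prime_rep_natK hp hK) ?(Tr_frob hp hK).
have rep_lt x : (rep x < p)%N by rewrite (prime_rep_lt hp hK) ?(Tr_frob hp hK).
pose N (t : 'I_p) := #|[set x : K | rep x == t]|.
have N_le t : (N t <= r * (A + 7))%N.
  apply: leq_trans (stepanov_count t%:R); apply: subset_leq_card.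
  by apply/subsetP => x; rewrite !inE -repK => /eqP ->.
have sumN : (\sum_t N t = r * r)%N.
  rewrite -expnD -hK -sum1_card (partition_big (fun x => Ordinal (rep_lt x)) xpredT) //=.
  by apply: eq_bigr => t _; rewrite sum1_card; apply: eq_card => x; rewrite !inE.
have -> : eps p (m + m) f = \sum_t ((N t)%:R * zeta_p p ^+ t).
  rewrite /eps (partition_big (fun x => Ordinal (rep_lt x)) xpredT) //=.
  apply: eq_bigr => t _; rewrite mulr_natl -sumr_const.
  apply: eq_big => [x|x /eqP <-] //.
  by rewrite !inE.
have sz : \sum_(t < p) zeta_p p ^+ t = 0.
  have p1 : zeta_p p != 1.
    by rewrite -[zeta_p p]expr1 -(prim_order_dvd z) dvdn1; apply: contraL hp => /eqP ->.
  apply: (mulfI (x := zeta_p p - 1)); first by rewrite subr_eq0.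
  by rewrite mulr0 -subrX1 (prim_expr_order z) subrr.
have -> : \sum_t (N t)%:R * zeta_p p ^+ t =
    - \sum_t (r * (A + 7) - N t)%N%:R * zeta_p p ^+ t.
  apply/eqP; rewrite -subr_eq0 opprK -big_split /=.
  under eq_bigr do rewrite -mulrDl -natrD subnKC //.
  by rewrite -mulr_sumr sz mulr0.
rewrite normrN (le_trans (ler_norm_sum _ _ _)) //.
under eq_bigr => t _.
  by rewrite normrM normr_nat normrX zeta_p_norm // expr1n mulr1; over.
rewrite -natr_sum ler_nat sumnB // sumN sum_nat_const card_ord.
by rewrite mulnDr mulnDr mulnCA -rpA; lia.
Qed.

End Stepanov.

(** * Cubic sums over a quadratic extension *)

Lemma size_X2_sub (K : fieldType) (d : K) : size ('X^2 - d%:P) = 3%N.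
Proof.
by rewrite size_polyDl size_polyXn // size_polyN (leq_ltn_trans (size_polyC_leq1 _)).
Qed.

Lemma irreducible_X2_sub (K : fieldType) (d : K) :
  (forall x, x ^+ 2 != d) -> irreducible_poly ('X^2 - d%:P).
Proof.
move=> nsq; apply: cubic_irreducible => [|x]; last first.
  by rewrite /root !hornerE subr_eq0 nsq.
by have -> : size ('X^2 - d%:P) = 3%N by exact: size_X2_sub.
Qed.

Section NonSquare.
Variable K : finFieldType.
Hypothesis two_neq0 : 2%:R != 0 :> K.

(** Squaring identifies 1 and -1, so on a finite set it is not surjective either. *)
Lemma exists_nonsquare : exists d : K, forall x, x ^+ 2 != d.
Proof.
have ninj : ~ injective (fun x : K => x ^+ 2).
  move=> /(_ 1 (-1)); rewrite sqrrN => /(_ erefl)/eqP.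
  by rewrite -subr_eq0 opprK -(natrD _ 1 1) (negPf two_neq0).
have : ~~ [forall d : K, [exists x : K, x ^+ 2 == d]].
  apply/negP => /forallP surj; apply: ninj.
  pose g d := xchoose (existsP (surj d)).
  have gK : cancel g (fun x => x ^+ 2) by move=> d; apply/eqP/(xchooseP (existsP (surj d))).
  have [h hK Kh] := injF_bij (can_inj gK).
  by apply: (can_inj (g := g)) => x; rewrite -[x in LHS]Kh gK Kh.
rewrite negb_forall => /existsP[d]; rewrite negb_exists => /forallP H.
by exists d.
Qed.

Variable d : K.
Hypothesis nsq : forall x, x ^+ 2 != d.

(** Each [t] has at most two preimages under [v ^+ 2] and [d * v ^+ 2] taken together. There are
    [2 * #|K|] arguments in all, so every [t] has exactly two. *)
Lemma sum_square_nonsquare (G : K -> algC) :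
  \sum_v (G (v ^+ 2) + G (d * v ^+ 2)) = 2%:R * \sum_t G t.
Proof.
pose phi (w : K * bool) := (if w.2 then d else 1) * w.1 ^+ 2.
pose N t := #|[set w | phi w == t]|.
have d0 : d != 0 by have := nsq 0; rewrite expr0n eq_sym.
have dne v v0 : v0 != 0 -> v ^+ 2 != d * v0 ^+ 2.
  move=> h0; apply: contraTneq (nsq (v / v0)) => E.
  by rewrite negbK expr_div_n E mulfK ?expf_neq0.
have N_le t : (N t <= 2)%N.
  rewrite /N; have [->|] := eqVneq [set w | phi w == t] set0; first by rewrite cards0.
  case/set0Pn => -[v0 b0]; rewrite inE => /eqP phi0.
  have [v00|v00] := eqVneq v0 0.
    apply: (@leq_trans #|[set (0 : K, true); (0, false)]|); last by rewrite cards2; case: (_ != _).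
    apply/subset_leq_card/subsetP => -[v b]; rewrite !inE -phi0 /phi v00 expr0n /= mulr0.
    rewrite mulf_eq0 expf_eq0 /= => /orP[|/eqP->]; last by case: b; rewrite eqxx ?orbT.
    by case: b; rewrite ?(negPf d0) ?oner_eq0.
  apply: (@leq_trans #|[set (v0, b0); (- v0, b0)]|); last by rewrite cards2; case: (_ != _).
  apply/subset_leq_card/subsetP => -[v b]; rewrite !inE -phi0 /phi /= !xpair_eqE -andb_orl.
  have [->|nb] := eqVneq b b0.
    have c0 : (if b0 then d else 1) != 0 by case: (b0); rewrite ?oner_eq0.
    by rewrite (inj_eq (mulfI c0)) eqf_sqr andbT.
  rewrite andbF => h; exfalso; move: nb h.
  case: b b0 phi0 => [] [] //= _ _; rewrite mul1r => /eqP E.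
    have [v1|v1] := eqVneq v 0; last by have := dne v0 v v1; rewrite E eqxx.
    by move: E; rewrite v1 expr0n mulr0 => /esym/eqP; rewrite expf_eq0 (negPf v00).
  by have := dne v v0 v00; rewrite E eqxx.
have sumN : (\sum_t N t = 2 * #|K|)%N.
  rewrite mulnC -card_bool -card_prod -sum1_card (partition_big phi xpredT) //=.
  by apply: eq_bigr => t _; rewrite sum1_card; apply: eq_card => w; rewrite !inE.
have N2 t : N t = 2%N.
  have : (\sum_t (2 - N t) = 0)%N.
    by rewrite sumnB // sumN sum_nat_const mulnC subnn.
  move/eqP; rewrite sum_nat_eq0 => /forallP/(_ t)/=; rewrite subn_eq0 => h.
  by apply/eqP; rewrite eqn_leq N_le.
transitivity (\sum_w G (phi w)).
  rewrite -(pair_bigA _ (fun v b => G (phi (v, b)))) /=; apply: eq_bigr => v _.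
  by rewrite big_bool /phi /= mul1r addrC.
rewrite (partition_big phi xpredT) //= mulr_sumr; apply: eq_bigr => t _.
rewrite -(N2 t) mulr_natl -sumr_const; apply: eq_big => [w|w /eqP -> //].
by rewrite inE.
Qed.

(* [s ^+ #|K| = - s] because otherwise ['X^#|K| - 'X] would vanish at [s] in
   addition to the [#|K|] elements of [K]. *)
Lemma quadratic_basis (L : finFieldType) (i : {rmorphism K -> L}) (s : L) :
    s ^+ 2 = i d -> #|L| = (#|K| ^ 2)%N ->
  s ^+ #|K| = - s /\ bijective (fun uv : K * K => i uv.1 + i uv.2 * s).
Proof.
move=> s2 cardL.
have notK x : i x != s.
  apply: contra_neq (nsq x) => E; apply: (fmorph_inj i).
  by rewrite rmorphXn /= -s2 E.
have i_inj : injective i := fmorph_inj i.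
have phi_inj : injective (fun uv : K * K => i uv.1 + i uv.2 * s).
  move=> [u v] [u' v'] /= E.
  have E1 : i (u - u') = i (v' - v) * s.
    by rewrite !rmorphB /= mulrBl; apply/eqP; rewrite subr_eq addrAC eq_sym subr_eq E addrC.
  have [vv|nv] := eqVneq (v' - v) 0.
    move: E1; rewrite vv rmorph0 mul0r => /eqP; rewrite fmorph_eq0 subr_eq0 => /eqP ->.
    by move/eqP: vv; rewrite subr_eq0 => /eqP ->.
  have := notK ((u - u') / (v' - v)).
  by rewrite fmorph_div E1 mulrC mulKf ?eqxx // fmorph_eq0.
split=> //; last first.
  by apply: inj_card_bij phi_inj _; rewrite card_prod cardL mulnn.
have : (s ^+ #|K| == s) || (s ^+ #|K| == - s).
  rewrite -eqf_sqr -exprM mulnC exprM s2.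
  by rewrite -rmorphXn expf_card.
case/orP => /eqP sq //; exfalso.
have szX : size ('X^#|K| - 'X : {poly L}) = #|K|.+1.
  by rewrite size_polyDl size_polyXn // size_polyN size_polyX ltnS finNzRing_gt1.
have := @max_poly_roots L ('X^#|K| - 'X) (s :: [seq i x | x <- enum K]).
rewrite -size_poly_eq0 szX /= size_map -cardE ltnn map_inj_uniq // enum_uniq andbT.
move=> H; suff: false by []; apply: H => //.
  rewrite /root !hornerE sq subrr eqxx /=; apply/allP => _ /mapP[x _ ->].
  by rewrite /root !hornerE -rmorphXn expf_card subrr.
by apply/negP => /mapP[x _ /eqP]; rewrite eq_sym (negPf (notK x)).
Qed.

Lemma quadratic_extension : exists (L : finFieldType) (i : {rmorphism K -> L}) (s : L),
  [/\ s ^+ 2 = i d, #|L| = (#|K| ^ 2)%N, s ^+ #|K| = - s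
    & bijective (fun uv : K * K => i uv.1 + i uv.2 * s)].
Proof.
have [L0 dimL [s]] := irredp_FAdjoin (irreducible_X2_sub nsq).
rewrite rmorphB /= map_polyXn map_polyC /= /root !hornerE subr_eq0 => /eqP s2 _.
pose L : finFieldType := finvect_type L0.
pose i : {rmorphism K -> L} := in_alg (finvect_type L0).
exists L, i, s.
have cardL : #|L| = (#|K| ^ 2)%N.
  have := @card_vspace K L (Vector.class (finvect_type L0)) {:finvect_type L0}%VS.
  rewrite -[\dim _]/(\dim {:L0}) dimL size_X2_sub => <-.
  by rewrite (@card_vspacef K L).
have s2' : (s : L) ^+ 2 = i d by [].
by have [] := quadratic_basis s2' cardL; split.
Qed.
End NonSquare.

Lemma prime_rep_morph (K L : finFieldType) (i : {rmorphism K -> L}) p y :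
  prime_rep p (i y) = prime_rep p y.
Proof.
rewrite /prime_rep -(index_map (fmorph_inj i)) -map_comp.
by congr index; apply: eq_map => n /=; rewrite rmorph_nat.
Qed.

Lemma Tr_morph (K L : finFieldType) (i : {rmorphism K -> L}) p e y :
  Tr p e (i y) = i (Tr p e y).
Proof. by rewrite /Tr rmorph_sum; apply: eq_bigr => j _; rewrite rmorphXn. Qed.

Lemma horner_cubic (R : finFieldType) (a b x : R) :
  (a *: 'X^3 + b *: 'X).[x] = a * x ^+ 3 + b * x.
Proof. by rewrite hornerD !hornerZ hornerXn hornerX. Qed.

Section Doubling.
Variables (K : finFieldType) (p e : nat).
Hypotheses (hp : prime p) (hp5 : (5 <= p)%N) (he : (0 < e)%N).
Hypothesis hK : #|K| = (p ^ e)%N.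
Local Notation q := (p ^ e)%N.

Let pK : p \in [pchar K] := card_finPcharP hK hp.
Let op : odd p.
Proof. by apply: contraLR hp5 => ev; case: (even_prime hp) => [->|] //; rewrite (negPf ev). Qed.

Lemma natK_neq0 n : (0 < n)%N -> coprime n p -> n%:R != 0 :> K.
Proof.
by move=> n0 cop; rewrite -(dvdn_pcharf pK) -prime_coprime // coprime_sym.
Qed.

(** The cubic is odd, so conjugation is undone by the substitution of [- x] for [x]. *)
Lemma eps_real a b : (eps p e (a *: 'X^3 + b *: 'X : {poly K}))^* = eps p e (a *: 'X^3 + b *: 'X).
Proof.
rewrite /eps rmorph_sum (reindex_inj oppr_inj) /=; apply: eq_bigr => x _.
rewrite (psi_conj hp hK op); congr psi; rewrite !horner_cubic; ring.
Qed.

Variables a b : K.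
Hypothesis a0 : a != 0.
Let f : {poly K} := a *: 'X^3 + b *: 'X.

(* The trace to [K] of [f (u + v sqrt d)] is [2a(u^3 + 3 d u v^2) + 2bu], and
   [f (u + v) + f (u - v)] is the same expression with [d = 1]; summing over v
   the two sums complete each other because squares and d times squares
   together cover [K] exactly twice. *)
Lemma eps_quadratic_extension : exists (L : finFieldType) (a' b' : L),
  [/\ #|L| = (p ^ (e + e))%N, a' != 0 &
   eps p (e + e) (a' *: 'X^3 + b' *: 'X) = 2%:R * q%:R - eps p e f ^+ 2].
Proof.
have two0 : 2%:R != 0 :> K by rewrite natK_neq0 // coprime2n.
have six0 : 6%:R != 0 :> K.
  rewrite (_ : 6 = 2 * 3)%N // natrM mulf_neq0 // natK_neq0 //.
  by rewrite coprime_sym prime_coprime // gtnNdvd //; lia.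
have [d nsq] := exists_nonsquare two0.
have [L [i [s [s2 cardL sq bij]]]] := quadratic_extension nsq.
have hL : #|L| = (p ^ (e + e))%N by rewrite cardL hK -expnM muln2 addnn.
have pL : p \in [pchar L] := card_finPcharP hL hp.
exists L, (i a), (i b); split=> //; first by rewrite fmorph_eq0.
(* Transitivity of the trace: [w + w ^+ q] is the relative trace of [w] from [L] to [K]. *)
have psiL (w : L) (t : K) : w + w ^+ q = i t -> psi p (e + e) w = psi p e t.
  move=> wt; rewrite /psi -(prime_rep_morph i) -Tr_morph -wt; congr (_ ^+ prime_rep _ _).
  rewrite /Tr big_split_ord /= -big_split /=; apply: eq_bigr => j _ /=.
  by rewrite exprDn_pchar_pow // -exprM -expnD.
have frobi x : i x ^+ q = i x by rewrite -hK -rmorphXn expf_card.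
pose c u : K := 2%:R * a * u ^+ 3 + 2%:R * b * u.
pose h u : K := 6%:R * a * u.
have epsL : eps p (e + e) (i a *: 'X^3 + i b *: 'X) =
    \sum_u \sum_v psi p e (c u + h u * (d * v ^+ 2)).
  rewrite pair_bigA /eps (reindex _ (onW_bij _ bij)) /=.
  apply: eq_bigr => -[u v] _ /=; apply: psiL; rewrite !horner_cubic.
  have fq z : (i a * z ^+ 3 + i b * z) ^+ q = i a * (z ^+ q) ^+ 3 + i b * z ^+ q.
    rewrite exprDn_pchar_pow // (exprMn_comm _ (mulrC _ _)) (exprMn_comm _ (mulrC _ z)).
    by rewrite !frobi [(z ^+ 3) ^+ _]exprAC.
  rewrite fq exprDn_pchar_pow // [(_ * s) ^+ q]exprMn !frobi -hK sq /c /h !(rmorphD, rmorphM, rmorphXn, rmorph_nat) /= -s2.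
  ring.
have eps2 : eps p e f ^+ 2 = \sum_u \sum_v psi p e (c u + h u * v ^+ 2).
  rewrite expr2 /eps mulr_suml.
  under eq_bigr do rewrite mulr_sumr.
  rewrite !pair_bigA /=.
  have bij2 : bijective (fun uv : K * K => (uv.1 + uv.2, uv.1 - uv.2)).
    apply: injF_bij => -[u v] [u' v'] /= [E1 E2].
    have eu : u = u'.
      apply: (mulfI two0); have dbl (x y : K) : 2%:R * x = (x + y) + (x - y) by ring.
      by rewrite (dbl u v) E1 E2 -dbl.
    by move: E1; rewrite eu => /addrI ->.
  rewrite (reindex _ (onW_bij _ bij2)) /=; apply: eq_bigr => -[u v] _ /=.
  rewrite -(psiD hp hK op); congr psi; rewrite /f !horner_cubic /c /h; ring.
apply/eqP; rewrite eq_sym subr_eq eq_sym; apply/eqP.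
(* For [u = 0] both double sums contribute [q]. For [u != 0] the coefficient [h u] is nonzero, and
   the combined sum over [v] is twice a full character sum, hence 0. *)
rewrite epsL eps2 -big_split /= (bigD1 0) //= [X in _ + X]big1 ?addr0 => [|u u0].
  rewrite -big_split /=.
  have c0 : c 0 = 0 by rewrite /c; ring.
  have h0 : h 0 = 0 by rewrite /h mulr0.
  under eq_bigr do rewrite c0 h0 !mul0r addr0 (psi0 hp hK op).
  by rewrite sumr_const -hK -(natrD _ 1 1) mulr_natr.
rewrite addrC -big_split /=.
under eq_bigr do rewrite !(psiD hp hK op) -mulrDr.
rewrite -mulr_sumr (sum_square_nonsquare nsq (fun t => psi p e (h u * t))).
by rewrite (sum_psi hp hK op he) ?mulr0 // /h !mulf_neq0.
Qed.

End Doubling.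

(** * The Weil bound for cubic sums *)

Section WeilBound.
Variable p : nat.
Hypotheses (hp : prime p) (hp5 : (5 <= p)%N).
Local Notation cubic a b := (a *: 'X^3 + b *: 'X).

Lemma eps_Creal (K : finFieldType) e (a b : K) :
  #|K| = (p ^ e)%N -> eps p e (cubic a b) \is Creal.
Proof. by move=> hK; apply/CrealP/(eps_real hp). Qed.

(** With [q = #|K|], the new defect is [(2q - E^2)^2 - 4q^2 = E^2 (E^2 - 4q)], and the first factor
    is at least [4q]. *)
Lemma eps_defect_growth (K : finFieldType) e (a b : K) (E := eps p e (cubic a b)) :
    #|K| = (p ^ e)%N -> (0 < e)%N -> a != 0 -> 4%:R * #|K|%:R <= E ^+ 2 ->
  exists (L : finFieldType) (a' b' : L), [/\ #|L| = (p ^ (e + e))%N, a' != 0 &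
    4%:R * #|K|%:R * (E ^+ 2 - 4%:R * #|K|%:R) <=
      eps p (e + e) (cubic a' b') ^+ 2 - 4%:R * #|L|%:R].
Proof.
move=> hK he a0 big.
have [L [a' [b' [hL a'0 E']]]] := eps_quadratic_extension hp hp5 he hK b a0.
exists L, a', b'; split=> //; rewrite E' -/E -hK.
have -> : #|L| = (#|K| * #|K|)%N by rewrite hL hK expnD.
rewrite natrM [leRHS](_ : _ = E ^+ 2 * (E ^+ 2 - 4%:R * #|K|%:R)); last by ring.
by rewrite ler_wpM2r // subr_ge0.
Qed.

(** Induction over successive quadratic extensions, with the Stepanov bound as base. Relative to the
    field order, the bound on the right is the same at every level, while a positive defect gains a
    factor of at least 4 each time. *)
Lemma eps_defect_bound n : forall (K : finFieldType) m (a b : K),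
  #|K| = (p ^ (m + m))%N -> (0 < m)%N -> a != 0 ->
  4%:R ^+ n * (eps p (m + m) (cubic a b) ^+ 2 - 4%:R * #|K|%:R)
     <= (7 * p)%N%:R ^+ 2 * #|K|%:R.
Proof.
elim: n => [|n IHn] K m a b hK hm a0.
  have szf : size (cubic a b) = 4%N.
    have sz3 : size (a *: 'X^3) = 4%N by rewrite size_scale // size_polyXn.
    rewrite size_polyDl sz3 //; apply: leq_ltn_trans (size_scale_leq _ _) _.
    by rewrite size_polyX.
  have := eps_stepanov_bound hp hp5 hm hK szf.
  rewrite expr0 mul1r lerBlDr => H; apply: (@le_trans _ _ ((7 * p)%N%:R ^+ 2 * #|K|%:R)).
    have -> : (7 * p)%N%:R ^+ 2 * #|K|%:R = (7 * p * p ^ m)%N%:R ^+ 2 :> algC.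
      by rewrite hK expnD !natrM; ring.
    by rewrite -real_normK ?(eps_Creal _ _ hK) // ler_pXn2r // nnegrE ?normr_ge0 ?ler0n.
  by rewrite lerDl mulr_ge0 ?ler0n.
set E := eps _ _ _.
have ER : E ^+ 2 \is Creal by rewrite rpredX // (eps_Creal _ _ hK).
have q0 : 0 < #|K|%:R :> algC by rewrite ltr0n hK expn_gt0 prime_gt0.
have qR : 4%:R * #|K|%:R \is Creal by rewrite rpredM ?rpred_nat.
have [le|lt] := real_leP ER qR.
  apply: (@le_trans _ _ 0); last by rewrite mulr_ge0 ?exprn_ge0 ?ler0n.
  by rewrite mulr_ge0_le0 ?exprn_ge0 ?ler0n // subr_le0.
have [|L [a' [b' [hL a'0 H]]]] := eps_defect_growth (b := b) hK _ a0 (ltW lt).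
  by rewrite addn_gt0 hm.
have := IHn L (m + m)%N a' b' hL _ a'0; rewrite addn_gt0 hm => /(_ isT) H2.
rewrite -(ler_pM2r q0).
apply: le_trans (le_trans H2 _); last by rewrite hL expnD -hK (natrM _ #|K|) mulrA.
rewrite exprSr -!mulrA ler_wpM2l ?exprn_ge0 ?ler0n //.
apply: le_trans H; rewrite -/E.
by rewrite [leLHS](_ : _ = 4%:R * #|K|%:R * (E ^+ 2 - 4%:R * #|K|%:R)) //; ring.
Qed.

(** If the bound failed, one doubling would reach a field of square order with defect at least
    [D > 0]. There [4 ^ n * D] is bounded by a constant for all [n], against the Archimedean
    property. *)
Lemma weil_cubic (K : finFieldType) e (a b : K) :
    #|K| = (p ^ e)%N -> (0 < e)%N -> a != 0 ->
  eps p e (cubic a b) <= 2%:R * sqrtC #|K|%:R.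
Proof.
move=> hK he a0; set E := eps _ _ _.
have ER : E \is Creal by rewrite (eps_Creal _ _ hK).
have q0 : 0 < #|K|%:R :> algC by rewrite ltr0n hK expn_gt0 prime_gt0.
suff E2 : E ^+ 2 <= 4%:R * #|K|%:R.
  apply: le_trans (real_ler_norm ER) _.
  rewrite -(@ler_pXn2r _ 2) ?nnegrE ?mulr_ge0 ?normr_ge0 ?sqrtC_ge0 ?ler0n //.
  by rewrite real_normK // exprMn sqrtCK -natrX.
have [//|lt] := real_leP (rpredX 2 ER) (rpredM (rpred_nat _ 4) (rpred_nat _ #|K|)).
have [L [a' [b' [hL a'0 H]]]] := eps_defect_growth (b := b) hK he a0 (ltW lt).
move: H; rewrite -/E; set D := _ * (_ - _) => H.
have D0 : 0 < D by rewrite mulr_gt0 ?subr_gt0 // (mulr_gt0 _ q0) ?ltr0n.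
pose B : algC := (7 * p)%N%:R ^+ 2 * #|L|%:R.
have B0 : 0 <= B by rewrite mulr_ge0 ?exprn_ge0 ?ler0n.
have key n : n%:R * D <= B.
  apply: le_trans (eps_defect_bound n b' hL he a'0).
  apply: (@le_trans _ _ (4%:R ^+ n * D)); last by rewrite ler_wpM2l ?exprn_ge0 ?ler0n.
  rewrite ler_wpM2r ?(ltW D0) // -natrX.
  by rewrite ler_nat ltnW // ltn_expl.
have := archi_boundP (divr_ge0 B0 (ltW D0)).
by rewrite ltr_pdivrMr // => /lt_le_trans/(_ (key _)); rewrite ltxx.
Qed.

End WeilBound.

(** * Spectra diagonalised by characters *)

Lemma char_poly_diag (R : comNzRingType) n (d : 'rV[R]_n) :
  char_poly (diag_mx d) = \prod_i ('X - (d 0 i)%:P).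
Proof.
rewrite char_poly_trig; last by apply/is_diag_mx_is_trig/diag_mx_is_diag.
by apply: eq_bigr => i _; rewrite mxE eqxx mulr1n.
Qed.

(** Take determinants in [(X - A) P = P (X - D)] over the polynomial ring and cancel [\det P]. *)
Lemma char_poly_intertwine (R : idomainType) n (A D P : 'M[R]_n) :
  \det P != 0 -> A *m P = P *m D -> char_poly A = char_poly D.
Proof.
move=> detP AP.
have detP' : \det (map_mx polyC P) != 0 by rewrite det_map_mx polyC_eq0.
apply: (mulIf detP'); rewrite /char_poly [RHS]mulrC -!det_mulmx; congr (\det _).
by rewrite mulmxBl mulmxBr -!map_mxM AP scalar_mxC.
Qed.

Lemma sum_enum_val (R : nmodType) (V : finType) (G : V -> R) :
  \sum_(i < #|V|) G (enum_val i) = \sum_a G a.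
Proof.
rewrite [RHS](reindex (@enum_val V predT)) //.
by exists enum_rank => x _; rewrite ?enum_rankK ?enum_valK.
Qed.

Section Spectrum.
Variables (V : finType) (adj : rel V) (X : V -> V -> algC) (lam : V -> algC).
Hypothesis X_eigen :
  forall w a, \sum_b (adj a b)%:R * X w b = lam w * X w a.
Hypothesis X_orth : forall w w',
  \sum_a X w a * (X w' a)^* = if w == w' then #|V|%:R else 0.
Hypothesis X_sym : forall w a, X w a = X a w.
Variable w0 : V.
Hypothesis X_w0 : forall a, X w0 a = 1.

Let V_neq0 : #|V|%:R != 0 :> algC.
Proof. by rewrite pnatr_eq0 -lt0n; apply/card_gt0P; exists w0. Qed.

(** The columns of [P] are the eigenvectors [X w]. Orthogonality makes the conjugate transpose of
    [P] times [P] a nonzero scalar matrix, so [\det P] is nonzero. *)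
Lemma char_poly_spectrum :
  char_poly (adj_mx adj) = \prod_w ('X - (lam w)%:P).
Proof.
pose P : 'M[algC]_#|V| := \matrix_(i, j) X (enum_val j) (enum_val i).
pose D := diag_mx (\row_(j < #|V|) lam (enum_val j)).
have PP : map_mx (fun x : algC => x^*) P^T *m P = (#|V|%:R)%:M.
  apply/matrixP => i j; rewrite !mxE.
  under eq_bigr do rewrite !mxE mulrC.
  rewrite (sum_enum_val (fun a => X (enum_val j) a * (X (enum_val i) a)^*)).
  by rewrite X_orth (inj_eq enum_val_inj) eq_sym; case: eqP.
rewrite (@char_poly_intertwine _ _ _ D P).
- rewrite char_poly_diag (reindex (@enum_rank V)) /=; last first.
    by exists enum_val => x _; rewrite ?enum_rankK ?enum_valK.
  by apply: eq_bigr => w _; rewrite mxE enum_rankK.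
- have : \det ((#|V|%:R)%:M : 'M[algC]_#|V|) != 0 by rewrite det_scalar expf_neq0.
  by rewrite -PP det_mulmx mulf_eq0 negb_or => /andP[].
apply/matrixP => i j; rewrite !mxE.
under eq_bigr do rewrite !mxE.
under [RHS]eq_bigr do rewrite !mxE.
rewrite [RHS](bigD1 j) //= eqxx mulr1n [X in _ + X]big1 ?addr0 => [|l /negPf lj]; last first.
  by rewrite lj mulr0n mulr0.
rewrite mulrC -X_eigen.
by rewrite (sum_enum_val (fun b => (adj (enum_val i) b)%:R * X (enum_val j) b)).
Qed.

(** The list is [lam w0] followed by the other eigenvalues sorted, so its entry of index 1 is their
    maximum. The order on [algC] is partial; sorting relies on the eigenvalues being real. *)
Lemma spectrum_lambda2 w1 :
    (forall w, lam w \is Creal) -> (forall w, lam w <= lam w0) ->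
    w1 != w0 -> (forall w, w != w0 -> lam w <= lam w1) ->
  is_lambda2 (adj_mx adj) (lam w1).
Proof.
move=> lamR lam0 w10 lam1.
pose ge (u v : algC) := v <= u.
pose s := [seq lam w | w <- enum (predC1 w0)].
have sR : all (mem Creal) s by apply/allP => _ /mapP[w _ ->]; apply: lamR.
have ge_total : {in mem Creal &, total ge}.
  by move=> x y xR yR; rewrite /ge orbC; apply: real_leVge.
exists (lam w0 :: sort ge s); split.
- rewrite char_poly_spectrum big_cons (bigD1 w0) //=; congr (_ * _).
  by rewrite (perm_big _ (permEl (perm_sort _ _))) big_map big_enum_cond /=; apply: eq_bigl => w; rewrite andbT.
- rewrite /= path_sortedE; last by move=> x y z xy yz; apply: le_trans yz xy.
  rewrite (sort_sorted_in ge_total sR) andbT.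
  by apply/allP => x; rewrite mem_sort => /mapP[w _ ->].
have w1s : lam w1 \in sort ge s by rewrite mem_sort map_f // mem_enum.
have : {in sort ge s, forall x, x <= lam w1}.
  by move=> x; rewrite mem_sort => /mapP[w]; rewrite mem_enum => /lam1 h ->.
have := sort_sorted_in ge_total sR; move: w1s; rewrite /=.
case: (sort ge s) => //= x t; rewrite inE => /orP[/eqP -> //|w1t].
rewrite path_sortedE; last by move=> u y z xy yz; apply: le_trans yz xy.
case/andP => /allP /(_ _ w1t) xge _ /(_ x); rewrite mem_head => /(_ isT) xle.
by apply/le_anti/andP.
Qed.

Hypothesis adj_sym : symmetric adj.

(* The indicator of a component is an eigenvector for the degree, so its
   Fourier coefficients at [w != w0] vanish and it is constant. *)
Lemma spectrum_connected :
  (forall w, w != w0 -> lam w != lam w0) -> connected_graph adj.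
Proof.
move=> lam_neq a b; have csym := sym_connect_sym adj_sym.
pose v c : algC := (connect adj a c)%:R.
have deg c : \sum_c' (adj c c')%:R = lam w0.
  have := X_eigen w0 c; rewrite X_w0 mulr1 => <-.
  by apply: eq_bigr => c' _; rewrite X_w0 mulr1.
have Av c : \sum_c' (adj c' c)%:R * v c' = lam w0 * v c.
  rewrite -(deg c) mulr_suml; apply: eq_bigr => c' _; rewrite adj_sym.
  case h : (adj c c'); last by rewrite !mul0r.
  by rewrite /v (same_connect_r csym (connect1 h)).
pose vhat w := \sum_c X w c * v c.
have vhat0 w : w != w0 -> vhat w = 0.
  move=> ww0; have : lam w * vhat w = lam w0 * vhat w.
    rewrite /vhat !mulr_sumr.
    under eq_bigr do rewrite mulrA -X_eigen mulr_suml.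
    rewrite exchange_big /=; apply: eq_bigr => c _.
    under eq_bigr do rewrite mulrAC.
    by rewrite -mulr_suml Av mulrCA mulrC mulrA.
  by move/eqP; rewrite -subr_eq0 -mulrBl mulf_eq0 subr_eq0 (negPf (lam_neq _ ww0)) => /eqP.
(* Fourier inversion: only the coefficient at [w0] survives, so [v] is constant. *)
have inv c : #|V|%:R * v c = vhat w0.
  transitivity (\sum_w (X w c)^* * vhat w).
    rewrite /vhat; under eq_bigr do rewrite mulr_sumr.
    rewrite exchange_big /= (bigD1 c) //= [X in _ = _ + X]big1 ?addr0 => [|c' cc'].
      under eq_bigr do rewrite mulrA ![X _ c]X_sym [_^* * _]mulrC.
      by rewrite -mulr_suml X_orth eqxx.
    under eq_bigr do rewrite mulrA ![X _ c]X_sym ![X _ c']X_sym [_^* * _]mulrC.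
    by rewrite -mulr_suml X_orth (negPf cc') mul0r.
  rewrite (bigD1 w0) //= big1 ?addr0 => [|w ww0]; last by rewrite vhat0 ?mulr0.
  by rewrite X_w0 rmorph1 mul1r.
have : v b = v a by apply: (mulfI V_neq0); rewrite !inv.
by rewrite /v connect0 => /eqP; case: connect => //; rewrite eq_sym oner_eq0.
Qed.

End Spectrum.

(** * The maximum M_q *)

(** Since [algC] is only partially ordered, the usual properties of an iterated maximum are derived
    from comparability of real elements. *)
Lemma bigmax_Creal (I : eqType) (r : seq I) (P : pred I) (x0 : algC) (G : I -> algC)
    (m := \big[Num.max/x0]_(i <- r | P i) G i) :
    x0 \is Creal -> (forall i, P i -> G i \is Creal) ->
  [/\ m \is Creal, x0 <= m, forall i, i \in r -> P i -> G i <= m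
    & m = x0 \/ exists2 i, P i & m = G i].
Proof.
move=> x0R GR; rewrite {}/m; elim: r => [|j r [mR x0m mG mex]].
  by rewrite big_nil; split=> //; left.
rewrite big_cons; case: ifP => Pj; last first.
  by split=> // i; rewrite inE => /predU1P[->|]; [rewrite Pj | apply: mG].
set m := \big[_/_]_(_ <- r | _) _ in mR x0m mG mex *.
have cmp := real_comparable (GR j Pj) mR.
split.
- by rewrite maxEle; case: ifP => _; [exact: mR | apply: GR].
- by rewrite comparable_le_max // x0m orbT.
- move=> i; rewrite inE comparable_le_max // => /predU1P[-> _|ir Pi]; first by rewrite lexx.
  by rewrite mG ?orbT.
by rewrite maxEle; case: ifP => _ //; right; exists j.
Qed.

Section ExpSum.
Variables (F : finFieldType) (p e : nat).
Hypotheses (hp : prime p) (he : (0 < e)%N) (hF : #|F| = (p ^ e)%N).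
Hypotheses (hodd : odd p) (hmod3 : ((p ^ e) %% 3 = 2)%N).
Local Notation psi := (@psi F p e).
Local Notation q := #|F|.
Local Notation M := (Mq F p e).

Definition cubic_sum (a b : F) : algC := eps p e (a *: 'X^3 + b *: 'X).
Local Notation E := cubic_sum.

Lemma cubic_sumE a b : E a b = \sum_x psi (a * x ^+ 3 + b * x).
Proof. by apply: eq_bigr => x _; rewrite horner_cubic. Qed.

(** The only odd prime below 5 is 3, and its positive powers are 0 modulo 3. *)
Lemma p_ge5 : (5 <= p)%N.
Proof.
have := prime_gt1 hp; case: p hodd hmod3 => [|[|[|[|[|n]]]]] // _.
by rewrite -[3%N]expn1 -(prednK he) expnS expn1 modnMr.
Qed.

Lemma card_ge5 : (5 <= q)%N.
Proof.
by rewrite hF (leq_trans p_ge5) // -{1}[p]expn1 leq_exp2l ?prime_gt1.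
Qed.

(** For [q = 3 s + 2] the inverse map is the power [2 s + 1], since [3 (2 s + 1) = 2 q - 1] and
    [x ^+ (2 q - 1) = x]. *)
Lemma cube_inj : injective (fun x : F => x ^+ 3).
Proof.
have qE : (2 * q - 1 = 3 * (2 * (q %/ 3) + 1))%N.
  have q3 : (q %% 3 = 2)%N by rewrite hF.
  by have := divn_eq q 3; rewrite q3; lia.
apply: (can_inj (g := fun x => x ^+ (2 * (q %/ 3) + 1))) => x /=.
rewrite -exprM -qE mul2n -addnn -addnBA ?(leq_trans _ card_ge5) //.
rewrite exprD expf_card -exprS subn1 prednK ?expf_card //.
exact: leq_trans card_ge5.
Qed.

Lemma cubic_sum00 : E 0 0 = q%:R.
Proof.
rewrite cubic_sumE; under eq_bigr do rewrite !mul0r addr0 (psi0 hp hF hodd).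
by rewrite sumr_const.
Qed.

Lemma cubic_sum_lin b : b != 0 -> E 0 b = 0.
Proof.
move=> b0; rewrite cubic_sumE; under eq_bigr do rewrite mul0r add0r.
exact: (sum_psi hp hF hodd he).
Qed.

Lemma cubic_sum_cube a : a != 0 -> E a 0 = 0.
Proof.
move=> a0; rewrite cubic_sumE; under eq_bigr do rewrite mul0r addr0.
have := sum_psi hp hF hodd he a0; rewrite (reindex_inj cube_inj); exact.
Qed.

Lemma cubic_sum_scale a b t : t != 0 -> E (a * t ^+ 3) (b * t) = E a b.
Proof.
move=> t0; rewrite !cubic_sumE [RHS](reindex_inj (mulfI t0)) /=.
by apply: eq_bigr => x _; congr psi; rewrite exprMn !mulrA.
Qed.

Lemma cubic_sum_Creal a b : E a b \is Creal.
Proof. exact: (eps_Creal hp p_ge5). Qed.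

Lemma cubic_sum_le_card a b : E a b <= q%:R.
Proof.
apply: le_trans (real_ler_norm (cubic_sum_Creal a b)) _.
rewrite cubic_sumE (le_trans (ler_norm_sum _ _ _)) //.
by under eq_bigr do rewrite (psi_norm _ hp hodd); rewrite sumr_const.
Qed.

Lemma Mq_spec : [/\ M \is Creal, forall a b, a != 0 -> b != 0 -> E a b <= M
  & exists a b, [/\ a != 0, b != 0 & M = E a b]].
Proof.
have E11 : eps p e ('X^3 + 'X : {poly F}) = E 1 1 by rewrite /E !scale1r.
have inner a := @bigmax_Creal F (index_enum F) (fun b => b != 0) (E 1 1) (E a)
  (cubic_sum_Creal 1 1) (fun b _ => cubic_sum_Creal a b).
have [] := @bigmax_Creal F (index_enum F) (fun a => a != 0) (E 1 1)
  (fun a => \big[Num.max/E 1 1]_(b | b != 0) E a b) (cubic_sum_Creal 1 1).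
  by move=> a _; case: (inner a).
rewrite /Mq E11 -/E => MR _ Mle Mex; split=> // [a b a0 b0|].
  apply: le_trans (Mle a _ a0); last exact: mem_index_enum.
  by case: (inner a) => _ _ le _; apply: le => //; apply: mem_index_enum.
have o1 := oner_neq0 F.
case: Mex => [->|[a a0 ->]]; first by exists 1, 1.
case: (inner a) => _ _ _ [->|[b b0 ->]]; first by exists 1, 1.
by exists a, b.
Qed.

(** By averaging: the sums [E 1 b] add up to [q] over all [b], and [E 1 0 = 0], so some [E 1 b] with
    [b != 0] is positive. Hence [M] also dominates the sums that vanish. *)
Lemma Mq_gt0 : 0 < M.
Proof.
have [MR Mle _] := Mq_spec.
have sumE : \sum_(b | b != 0) E 1 b = q%:R.
  have : \sum_b E 1 b = q%:R.
    under eq_bigr do rewrite cubic_sumE.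
    rewrite exchange_big /= (bigD1 0) //= [X in _ + X]big1 ?addr0 => [|x x0].
      under eq_bigr do rewrite expr0n !mulr0 addr0 (psi0 hp hF hodd).
      by rewrite sumr_const.
    under eq_bigr do rewrite (psiD hp hF hodd) mulrC [_ * x]mulrC.
    by rewrite -mulr_suml (sum_psi hp hF hodd he x0) mul0r.
  by rewrite (bigD1 0) //= cubic_sum_cube ?oner_neq0 // add0r.
have [//|M0] := real_ltP (rpred0 _) MR.
have : (q%:R : algC) <= 0.
  rewrite -sumE; apply: sumr_le0 => b b0.
  by apply: le_trans M0; apply: Mle => //; apply: oner_neq0.
by rewrite lern0 => /eqP q0; have := card_ge5; rewrite q0.
Qed.

Lemma cubic_sum_le_Mq a b : (a != 0) || (b != 0) -> E a b <= M.
Proof.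
have [_ Mle _] := Mq_spec.
have [->|a0] := eqVneq a 0; have [->|b0] := eqVneq b 0 => //= _.
- by rewrite cubic_sum_lin // ltW // Mq_gt0.
- by rewrite cubic_sum_cube // ltW // Mq_gt0.
exact: Mle.
Qed.

Lemma Mq_le_weil : M <= 2%:R * sqrtC q%:R.
Proof.
have [_ _ [a [b [a0 _ ->]]]] := Mq_spec.
exact: (weil_cubic hp p_ge5).
Qed.

(** As [q > 4], the Weil bound lies strictly below [q]. This gap separates the degree from the other
    eigenvalues. *)
Lemma Mq_lt_card : M < q%:R.
Proof.
apply: le_lt_trans Mq_le_weil _; rewrite -[X in _ < X]sqrtCK expr2.
have s0 : 0 < sqrtC q%:R :> algC by rewrite sqrtC_gt0 ltr0n (leq_trans _ card_ge5).
rewrite ltr_pM2r // -(@ltr_pXn2r _ 2) ?nnegrE ?ler0n ?(ltW s0) //.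
by rewrite sqrtCK -natrX ltr_nat; apply: card_ge5.
Qed.

End ExpSum.

(** * Eigenvalues of the graph *)

Section Graph.
Variables (F : finFieldType) (p e k : nat).
Hypotheses (hp : prime p) (he : (0 < e)%N) (hF : #|F| = (p ^ e)%N).
Hypotheses (hodd : odd p) (hmod3 : ((p ^ e) %% 3 = 2)%N).
Hypothesis hk : (4 <= k <= (p ^ e).+1)%N.
Local Notation V := {ffun 'I_k -> F}.
Local Notation psi := (@psi F p e).
Local Notation q := #|F|.
Local Notation M := (Mq F p e).
Local Notation E := (@cubic_sum F p e).
Local Notation adj :=
  (@S_adj F k (fun i => 'X^(i.-1)) (fun=> 'X^3)).

Let k_gt0 : (0 < k)%N. Proof. by case/andP: hk => /(leq_trans _)->. Qed.
Let k_gt1 : (1 < k)%N. Proof. by case/andP: hk => /(leq_trans _)->. Qed.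
Let o0 := Ordinal k_gt0.
Let o1 := Ordinal k_gt1.

Lemma coordE (a : V) (i : 'I_k) : Defs.coord a i = a i.
Proof. by rewrite /Defs.coord valK. Qed.

(** Parametrises the connection set of the Cayley graph by the first difference [x] and the slope
    [y]. The 0-based position [i] carries the polynomial of index [i + 1], whence the exponent
    [i]. *)
Definition conn_vec (x y : F) : V :=
  [ffun i : 'I_k => if i == o0 then x else if i == o1 then x * y else x ^+ 3 * y ^+ i].

Lemma ord_ge2 (i : 'I_k) : (2 <= i)%N = (i != o0) && (i != o1).
Proof. by rewrite -!val_eqE /=; case: (i : nat) => [|[|]]. Qed.

Lemma S_adjP (a b : V) : adj a b =
  (b o0 != a o0) && (b == a + conn_vec (b o0 - a o0) ((b o1 - a o1) / (b o0 - a o0))).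
Proof.
rewrite /S_adj -[0%N]/(val o0) -[1%N]/(val o1) !coordE eq_sym.
have [//|ne] := eqVneq (b o0) (a o0); rewrite /=.
set x := b o0 - a o0; set y := _ / x.
have x0 : x != 0 by rewrite subr_eq0.
apply/forallP/eqP => [H|-> i].
  apply/ffunP => i; rewrite !ffunE.
  case: eqP => [->|/eqP i0]; first by rewrite /x addrC subrK.
  case: eqP => [->|/eqP i1]; first by rewrite /y mulrCA divff // mulr1 addrC subrK.
  have := H i; rewrite ord_ge2 i0 i1 /= => /eqP h.
  by rewrite -[LHS](subrK (a i)) h !hornerXn addrC.
rewrite ord_ge2; apply/implyP => /andP[/negPf i0 /negPf i1].
by rewrite !ffunE i0 i1 addrC addrA addNr add0r !hornerXn.
Qed.

Lemma S_adj_sym : symmetric adj.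
Proof.
move=> a b; rewrite /S_adj eq_sym; congr (_ && _); apply: eq_forallb => i.
congr (_ ==> _); rewrite !hornerXn -(opprB (Defs.coord b 0)) -(opprB (Defs.coord b 1)) invrN mulrNN.
by rewrite -(opprB (b i)) -(inj_eq oppr_inj) -mulNr; congr (_ == _ * _); ring.
Qed.

Definition dot (w a : V) : F := \sum_i w i * a i.
Definition chi (w a : V) : algC := psi (dot w a).

Lemma dotC w a : dot w a = dot a w.
Proof. by apply: eq_bigr => i _; rewrite mulrC. Qed.

Lemma dotDr w a b : dot w (a + b) = dot w a + dot w b.
Proof. by rewrite -big_split; apply: eq_bigr => i _; rewrite ffunE mulrDr. Qed.

Lemma chi_sum (w : V) : \sum_a chi w a = if w == 0 then #|{: V}|%:R else 0.
Proof.
case: eqP => [->|/eqP w0].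
  rewrite -sum1_card natr_sum; apply: eq_bigr => a _.
  rewrite /chi /dot big1 ?(psi0 hp hF hodd) // => i _.
  by rewrite ffunE mul0r.
have [i wi] : exists i, w i != 0.
  apply/existsP; apply: contraNT w0; rewrite negb_exists => /forallP H.
  by apply/eqP/ffunP => i; rewrite ffunE; apply/eqP/negPn.
have [t Tt] := Tr_neq0 hp hF he.
have pt : psi t != 1.
  rewrite /Defs.psi -(prim_order_dvd (zeta_p_prim hp hodd)).
  rewrite (dvdn_pcharf (card_finPcharP hF hp)).
  by rewrite (prime_rep_natK hp hF) ?(Tr_frob hp hF).
pose a0 : V := [ffun j => if j == i then t / w i else 0].
have wa0 : dot w a0 = t.
  rewrite /dot (bigD1 i) //= big1 ?addr0 => [|j ji]; rewrite ffunE ?eqxx.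
    by rewrite mulrCA divff // mulr1.
  by rewrite (negPf ji) mulr0.
have Eq : psi t * \sum_a chi w a = \sum_a chi w a.
  rewrite mulr_sumr [RHS](reindex_inj (addrI a0)) /=; apply: eq_bigr => a _.
  by rewrite /chi dotDr wa0 (psiD hp hF hodd).
apply/eqP; apply: contraNT pt => s0; apply/eqP.
by apply: (mulIf s0); rewrite Eq mul1r.
Qed.

Lemma chi_orth (w w' : V) :
  \sum_a chi w a * (chi w' a)^* = if w == w' then #|{: V}|%:R else 0.
Proof.
rewrite -subr_eq0 -chi_sum; apply: eq_bigr => a _.
rewrite /chi (psi_conj hp hF hodd) -(psiD hp hF hodd); congr psi.
rewrite /dot -sumrN -big_split; apply: eq_bigr => i _.
by rewrite !ffunE mulrBl.
Qed.

Definition lam (w : V) : algC := \sum_(x | x != 0) \sum_y chi w (conn_vec x y).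

Lemma chi_eigen (w a : V) : \sum_b (adj a b)%:R * chi w b = lam w * chi w a.
Proof.
rewrite (bigID (adj a)) /= addrC big1 ?add0r => [|b /negPf ->]; last by rewrite mul0r.
(* The neighbours of [a] are the points [h (x, y)] with [x != 0], and [h'] recovers the parameters
   from a neighbour. *)
pose h (xy : F * F) : V := a + conn_vec xy.1 xy.2.
pose h' (b : V) : F * F := (b o0 - a o0, (b o1 - a o1) / (b o0 - a o0)).
have h0 xy : (h xy) o0 - a o0 = xy.1 by rewrite !ffunE eqxx addrAC subrr add0r.
have h1 xy : (h xy) o1 - a o1 = xy.1 * xy.2.
  by rewrite !ffunE /= addrAC subrr add0r.
rewrite (reindex_onto h h') /=; last by move=> b; rewrite S_adjP => /andP[_ /eqP {2}->].
rewrite /lam pair_big_dep /= mulr_suml; apply: eq_big => [[x y]|[x y]].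
  rewrite S_adjP /h' h0 h1 /= xpair_eqE eqxx /= -subr_eq0 h0 /=.
  by have [//|x0] := eqVneq x 0; rewrite mulrC mulKf // !eqxx.
rewrite /h' => /andP[-> _]; rewrite mul1r /chi dotDr (psiD hp hF hodd).
exact: mulrC.
Qed.

Definition cubic_coef (w : V) (y : F) : F := \sum_(i < k | (2 <= i)%N) w i * y ^+ i.

Lemma dot_conn_vec w x y :
  dot w (conn_vec x y) = cubic_coef w y * x ^+ 3 + (w o0 + w o1 * y) * x.
Proof.
rewrite /dot (bigD1 o0) //= (bigD1 o1) //= addrA addrC; congr (_ + _).
  rewrite mulr_suml; apply: eq_big => [i|i /andP[/negPf i0 /negPf i1]].
    by rewrite ord_ge2.
  by rewrite ffunE i0 i1 -mulrA [y ^+ _ * _]mulrC.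
by rewrite !ffunE /=; ring.
Qed.

(** Adding the terms with [x = 0], one for each [y], completes the exponential sums and accounts for
    [- q]. *)
Lemma lamE w : lam w = \sum_y E (cubic_coef w y) (w o0 + w o1 * y) - q%:R.
Proof.
apply/eqP; rewrite eq_sym subr_eq eq_sym; apply/eqP.
under [RHS]eq_bigr do rewrite cubic_sumE.
rewrite exchange_big /= (bigD1 0) //= addrC /lam; congr (_ + _).
  by apply: eq_bigr => x _; apply: eq_bigr => y _; rewrite /chi dot_conn_vec.
under eq_bigr do rewrite expr0n !mulr0 addr0 (psi0 hp hF hodd).
by rewrite sumr_const.
Qed.

Lemma lam_Creal w : lam w \is Creal.
Proof.
rewrite lamE rpredB ?rpred_nat // rpred_sum // => y _.
exact: (cubic_sum_Creal hp he hF hodd hmod3).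
Qed.

Lemma lam0 : lam 0 = (q * (q - 1))%N%:R.
Proof.
have H0 y : cubic_coef 0 y = 0 by apply: big1 => i _; rewrite ffunE mul0r.
rewrite lamE; under eq_bigr do rewrite H0 !ffunE mul0r addr0 (cubic_sum00 hp hF hodd).
have q0 : (0 < q)%N by rewrite hF expn_gt0 prime_gt0.
by rewrite sumr_const -mulrnA -natrB ?leq_pmull // mulnBr muln1.
Qed.

Lemma lam_zeros (w : V) : w o0 = 0 -> w o1 = 0 ->
  lam w = q%:R * (#|[set y | cubic_coef w y == 0]|%:R - 1).
Proof.
move=> w0 w1; rewrite lamE (bigID (fun y => cubic_coef w y == 0)) /= w0 w1.
rewrite [X in _ + X - _]big1 ?addr0 => [|y Hy]; last first.
  by rewrite mul0r addr0 (cubic_sum_cube hp he hF hodd hmod3).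
rewrite mulrBr mulr1; congr (_ - _); rewrite mulr_natr -sumr_const.
apply: eq_big => [y|y /eqP ->]; first by rewrite inE.
by rewrite mul0r addr0 (cubic_sum00 hp hF hodd).
Qed.

(** The polynomial is [y ^+ 2 * Q.[y]] with [Q] of degree at most [k - 3]. Its zeros are 0 and at
    most [k - 3] nonzero roots of [Q]. *)
Lemma card_zeros_le (w : V) : w o0 = 0 -> w o1 = 0 -> w != 0 ->
  (#|[set y | cubic_coef w y == 0%R]| <= k - 2)%N.
Proof.
move=> w00 w10 w0; pose Q : {poly F} := \poly_(i < k - 2) Defs.coord w (i + 2).
have HQ y : cubic_coef w y = y ^+ 2 * Q.[y].
  rewrite horner_poly mulr_sumr /cubic_coef.
  under eq_bigr do rewrite -coordE.
  rewrite -(big_mkord (fun i => (2 <= i)%N) (fun i => Defs.coord w i * y ^+ i)).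
  rewrite -(big_mkord xpredT (fun i => y ^+ 2 * (Defs.coord w (i + 2) * y ^+ i))).
  rewrite (big_cat_nat (n := 2)) //= [X in X + _]big_nat_cond big1 ?add0r; last first.
    by move=> i /andP[/andP[_ i2] i2']; move: i2'; rewrite leqNgt i2.
  rewrite -{1}[2%N]add0n big_addn big_nat_cond [RHS]big_nat_cond.
  apply: eq_big => i; first by rewrite leq_addl.
  by move=> _; rewrite exprD; ring.
have Q0 : Q != 0.
  apply: contraNneq w0 => Q0; apply/eqP/ffunP => i; rewrite ffunE.
  have [->//|i0] := eqVneq i o0; have [->//|i1] := eqVneq i o1.
  have i2 : (2 <= i)%N by rewrite ord_ge2 i0.
  have := coef_poly (k - 2) (fun i => Defs.coord w (i + 2)) (i - 2).
  have -> : (i - 2 < k - 2)%N by have := ltn_ord i; lia.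
  by rewrite -/Q Q0 coef0 subnK // coordE => <-.
pose s := enum [set y | (y != 0) && root Q y].
have szs : (size s < size Q)%N.
  rewrite max_poly_roots ?enum_uniq //.
  by apply/allP => y; rewrite mem_enum inE => /andP[].
have : [set y | cubic_coef w y == 0] \subset 0 |: [set y | (y != 0) && root Q y].
  apply/subsetP => y; rewrite !inE HQ mulf_eq0 expf_eq0 /=.
  by case: (y == 0).
move/subset_leq_card/leq_trans; apply; rewrite (leq_trans (leq_card_setU _ _)) // cards1 add1n.
by rewrite cardE (leq_trans szs) // size_poly.
Qed.

(* A linear coefficient that is not identically zero vanishes for at most one
   [y]; that summand is at most [q], which the [- q] in [lamE] absorbs. *)
Lemma lam_le_Mq (w : V) : (w o0 != 0) || (w o1 != 0) -> lam w <= (q - 1)%N%:R * M.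
Proof.
move=> w01; rewrite lamE.
have [y0 Hy0] : exists y0, forall y, y != y0 -> w o0 + w o1 * y != 0.
  have [w1|w1] := eqVneq (w o1) 0.
    by exists 0 => y _; rewrite w1 mul0r addr0; rewrite w1 eqxx orbF in w01.
  exists (- w o0 / w o1) => y; apply: contraNneq => /eqP.
  by rewrite addrC addr_eq0 => /eqP h; apply/eqP/(mulfI w1); rewrite h mulrCA divff // mulr1.
rewrite lerBlDl (bigD1 y0) //= lerD //; first exact: (cubic_sum_le_card hp he hF hodd hmod3).
have -> : (q - 1)%N%:R * M = \sum_(y | y != y0) M.
  by rewrite sumr_const mulr_natl subn1 -(cardC1 y0).
apply: ler_sum => y /Hy0 h.
by rewrite (cubic_sum_le_Mq hp he hF hodd hmod3) // h orbT.
Qed.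

Lemma lam_le (w : V) : w != 0 ->
  lam w <= q%:R * (k - 3)%N%:R \/ lam w <= (q - 1)%N%:R * M.
Proof.
move=> w0; have [|] := boolP ((w o0 != 0) || (w o1 != 0)); first by right; apply: lam_le_Mq.
rewrite negb_or !negbK => /andP[/eqP w00 /eqP w10]; left.
rewrite lam_zeros // ler_wpM2l ?ler0n // lerBlDr natr1 ler_nat.
by have := card_zeros_le w00 w10 w0; case/andP: hk; lia.
Qed.

Lemma lam_Mq_attained : exists2 w, w != 0 & lam w = (q - 1)%N%:R * M.
Proof.
have [_ _ [a [b [a0 b0 Mab]]]] := Mq_spec hp he hF hodd hmod3.
have k3 : (3 < k)%N by case/andP: hk.
pose w : V := [ffun i : 'I_k => if i == o1 then b else if i == Ordinal k3 then a else 0].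
have w0 : w o0 = 0 by rewrite ffunE.
have w1 : w o1 = b by rewrite ffunE eqxx.
have Hw y : cubic_coef w y = a * y ^+ 3.
  rewrite /cubic_coef (bigD1 (Ordinal k3)) //= ffunE eqxx big1 ?addr0 // => i.
  rewrite ord_ge2 => /andP[/andP[_ /negPf i1] /negPf i3].
  by rewrite ffunE i1 i3 mul0r.
exists w; first by apply: contraNneq b0 => wz; rewrite -w1 wz ffunE.
(* The summand at [y = 0] is [E 0 0 = q], which cancels [- q]; each of the other [q - 1] summands
   equals [M] by scaling. *)
rewrite lamE (bigD1 0) //= Hw w0 w1 expr0n /= !mulr0 addr0 (cubic_sum00 hp hF hodd).
rewrite addrAC subrr add0r.
transitivity (\sum_(y : F | y != 0) M); last by rewrite sumr_const mulr_natl subn1 -(cardC1 (0 : F)).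
by apply: eq_bigr => y y0; rewrite Hw add0r cubic_sum_scale // Mab.
Qed.

(** Take the coefficients of [X^2] times [k - 3] linear factors with distinct nonzero roots,
    available because [k <= q + 1]. The factor [X^2] makes coordinates 0 and 1 vanish and adds the
    zero 0, for [k - 2] zeros in all. *)
Lemma lam_zeros_attained : exists2 w, w != 0 & lam w = q%:R * (k - 3)%N%:R.
Proof.
have /andP[k4 kq] := hk; rewrite -hF in kq.
pose nz := enum (predC1 (0 : F)).
have sznz : size nz = q.-1 by rewrite -cardE cardC1.
pose C := take (k - 3) nz.
have szC : size C = (k - 3)%N by rewrite size_takel // sznz; lia.
pose P : {poly F} := 'X^2 * \prod_(c <- C) ('X - c%:P).
have szP : size P = k.
  rewrite /P mulrC size_mulXn ?size_prod_XsubC ?szC; last first.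
    by rewrite -size_poly_eq0 size_prod_XsubC.
  lia.
have cP i : (i < 2)%N -> P`_i = 0 by move=> i2; rewrite /P mulrC coefMXn i2.
pose w : V := [ffun i : 'I_k => P`_i].
have Hw y : cubic_coef w y = P.[y].
  rewrite horner_coef szP [RHS](bigID (fun i : 'I_k => (2 <= i)%N)) /= [X in _ = _ + X]big1 ?addr0.
    by apply: eq_bigr => i _; rewrite ffunE.
  by move=> i; rewrite -ltnNge => i2; rewrite cP ?mul0r.
have P0 : P != 0 by rewrite -size_poly_eq0 szP; lia.
exists w.
  have k1 : (k.-1 < k)%N by rewrite prednK.
  apply: contraNneq P0 => /ffunP/(_ (Ordinal k1)); rewrite !ffunE /= => h.
  by rewrite -lead_coef_eq0 lead_coefE szP h.
rewrite lam_zeros ?ffunE ?cP //; congr (_ * _).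
have -> : [set y | cubic_coef w y == 0] = [set y in 0 :: C].
  apply/setP => y; rewrite !inE Hw /P hornerM hornerXn mulf_eq0 expf_eq0 /=; congr (_ || _).
  exact: root_prod_XsubC.
have uC : uniq (0 :: C).
  rewrite /= take_uniq ?enum_uniq // andbT; apply/negP => /mem_take.
  by rewrite mem_enum inE eqxx.
by rewrite cardsE (card_uniqP uC) /= szC -natr1 addrK.
Qed.

End Graph.

Theorem theorem3 (F : finFieldType) (p e : nat)
  (hp : prime p) (he : (0 < e)%N) (hF : #|F| = (p ^ e)%N)
  (hodd : odd p) (hmod3 : ((p ^ e) %% 3 = 2)%N)
  (k : nat) (hk : (4 <= k <= (p ^ e).+1)%N) :
  let f := fun i : nat => ('X^(i.-1) : {poly F}) in
  let g := fun _ : nat => ('X^3 : {poly F}) in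
  let q := (p ^ e)%N in
  connected_graph (@S_adj F k f g) /\
  is_lambda2 (adj_mx (@S_adj F k f g))
    (Num.max (q%:R * (k - 3)%N%:R) ((q - 1)%N%:R * Mq F p e)) /\
  Mq F p e <= 2%:R * sqrtC q%:R.
Proof.
move=> f g q; rewrite {}/q -hF.
have MR : Mq F p e \is Creal by have [] := Mq_spec hp he hF hodd hmod3.
have q5 := card_ge5 hp he hF hodd hmod3.
have /andP[k4 kq] := hk; rewrite -hF in kq.
set m1 := #|F|%:R * _; set m2 := _ * Mq F p e.
have cmp : m1 >=< m2.
  by apply: real_comparable; rewrite !(rpredM, rpred_nat).
have le_max (w : {ffun 'I_k -> F}) : w != 0 -> lam hk w <= Num.max m1 m2.
  move=> w0; rewrite comparable_le_max //; apply/orP.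
  exact: (lam_le hp he hF hodd hmod3).
have [w1 w10 lamw1] : exists2 w1 : {ffun 'I_k -> F}, w1 != 0 & lam hk w1 = Num.max m1 m2.
  rewrite maxEle; case: ifP => _.
    exact: (lam_Mq_attained hp he hF hodd hmod3).
  exact: (lam_zeros_attained hp he hF hodd hmod3).
(* The degree is [q (q - 1)]: it exceeds [q (k - 3)] because [k <= q + 1], and [(q - 1) M] because
   [M < q]. This strict gap yields connectedness. *)
have lam_lt (w : {ffun 'I_k -> F}) : w != 0 -> lam hk w < lam hk (0 : {ffun 'I_k -> F}).
  move=> w0; apply: le_lt_trans (le_max w w0) _.
  rewrite (lam0 hp hF hodd hk) comparable_gt_max // /m1 /m2 natrM; apply/andP; split.
    by rewrite -!natrM ltr_nat ltn_pmul2l; lia.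
  rewrite mulrC ltr_pM2r ?(Mq_lt_card hp he hF hodd hmod3) //.
  by rewrite ltr0n; lia.
have eigen := chi_eigen hp hF hodd hk.
have orth := chi_orth hp he hF hodd (k := k).
have chiC (w a : {ffun 'I_k -> F}) : chi p e w a = chi p e a w by rewrite /chi dotC.
have chi0 a : chi p e (0 : {ffun 'I_k -> F}) a = 1.
  rewrite /chi /dot big1 ?(psi0 hp hF hodd) // => i _.
  by rewrite ffunE mul0r.
split; last split; last exact: (Mq_le_weil hp he hF hodd hmod3).
  apply: (spectrum_connected eigen orth chiC chi0).
    exact: S_adj_sym.
  by move=> w /lam_lt; rewrite lt_neqAle => /andP[].
rewrite -lamw1; apply: (spectrum_lambda2 eigen orth) => //.
- exact: (lam_Creal hp he hF hodd hmod3 hk).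
- by move=> w; have [->//|/lam_lt/ltW] := eqVneq w 0.
- exact: w10.
by move=> w /le_max; rewrite lamw1.
Qed.
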